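(* Let $1\to N\to G\xrightarrow{q} H\to 1$ be a short exact sequence of (discrete) groups, with $N$ regarded as a normal subgroup of $G$, and let $\sigma:H\to G$ be a normalized section of $q$. Let $(\bar S,\bar\omega)$ be the associated $(\mathbb{C}[N],H)$-crossed system and $\mathbb{C}[N]\times_{(\bar S,\bar\omega)}H$ the associated crossed product. Writing each element $f\in\mathbb{C}[G]$ uniquely as a finite sum $f=\sum_{h\in H} f_h\star\delta_{\sigma(h)}$ with $f_h\in\mathbb{C}[N]$, the map $$\Phi:\mathbb{C}[G]\to\mathbb{C}[N]\times_{(\bar S,\bar\omega)}H,\qquad \sum_{h\in H} f_h\star\delta_{\sigma(h)}\mapsto\sum_{h\in H} f_h d_h,$$ is an isomorphism of $(\mathbb{C}[N],H)$-crossed products.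
   Context: For a group $G$, $\mathbb{C}[G]$ is the complex group ring (finitely supported functions $G\to\mathbb{C}$) with convolution product $\star$; $\delta_g$ is the Dirac function at $g\in G$, so $\delta_g\star\delta_{g'}=\delta_{gg'}$. A section $\sigma:H\to G$ of $q$ is a map with $q\circ\sigma=\mathrm{id}_H$; it is normalized if $\sigma(e_H)=e_G$. Put $\omega(h,h'):=\sigma(h)\sigma(h')\sigma(hh')^{-1}\in N$ for $h,h'\in H$. Define $\bar S:H\to\mathrm{Aut}(\mathbb{C}[N])$ by $\bar S(h)(f):=\delta_{\sigma(h)}\star f\star\delta_{\sigma(h)^{-1}}$ and $\bar\omega:H\times H\to\mathbb{C}[N]^\times$ by $\bar\omega(h,h'):=\delta_{\omega(h,h')}$. The crossed product $\mathbb{C}[N]\times_{(\bar S,\bar\omega)}H$ is the vector space $\bigoplus_{h\in H}\mathbb{C}[N]d_h$ (the free left $\mathbb{C}[N]$-module with basis $(d_h)_{h\in H}$) with the bilinear multiplication determined by $$fd_h\bullet f'd_{h'}:=f\star\bar S(h)(f')\star\bar\omega(h,h')\,d_{hh'},\qquad f,f'\in\mathbb{C}[N],\ h,h'\in H;$$ it is a unital associative algebra with identity $d_e$. A unital $H$-graded ring $R=\bigoplus_{h\in H}R_h$ (with $R_hR_{h'}\subseteq R_{hh'}$) is an $(R_e,H)$-crossed product if each $R_h$ contains an invertible element of $R$. Here $\mathbb{C}[G]$ is a $(\mathbb{C}[N],H)$-crossed product with homogeneous components $\mathbb{C}[N]\star\delta_{\sigma(h)}$, and $\mathbb{C}[N]\times_{(\bar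 S,\bar\omega)}H$ is one with homogeneous components $\mathbb{C}[N]d_h$. An isomorphism of $(\mathbb{C}[N],H)$-crossed products is a unital algebra isomorphism mapping the component of degree $h$ onto the component of degree $h$ for every $h\in H$. *)

(* Defs.v *)
From HB Require Import structures.
From mathcomp Require Import all_boot all_order all_algebra finmap complex reals.
From mathcomp Require Import monalg.

Set Implicit Arguments.
Unset Strict Implicit.
Unset Printing Implicit Defensive.

Import GRing.Theory.
Local Open Scope ring_scope.

(* [malg] is used only as the additive group of finitely supported functions:
   its library multiplication needs a [monomType], where [x * y = 1] forces
   [x = y = 1], so it never applies to a group.                               *)

(* -------------------------------------------------------------------------- *)
Section LinearExtension.
Context (I : choiceType) (A B : zmodType) (F : I -> A -> B).
Hypothesis F_D : forall i, {morph F i : x y / x + y}.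

Lemma lext_F0 i : F i 0 = 0.
Proof. by apply: (addrI (F i 0)); rewrite -F_D !addr0. Qed.

Definition lext (f : {malg A[I]}) : B := \sum_(i <- msupp f) F i f@_i.

Lemma lextw (d : {fset I}) f : (msupp f `<=` d)%fset ->
  lext f = \sum_(i <- d) F i f@_i.
Proof.
move=> le; rewrite /lext (big_fset_incl _ le) // => i _ /mcoeff_outdom ->.
exact: lext_F0.
Qed.

Lemma lextD : {morph lext : f g / f + g}.
Proof.
move=> f g; rewrite (lextw (msuppD_le f g)).
rewrite (lextw (fsubsetUl _ (msupp g))) (lextw (fsubsetUr (msupp f) _)).
by rewrite -big_split; apply: eq_bigr => i _; rewrite mcoeffD F_D.
Qed.

Lemma lext0 : lext 0 = 0.
Proof. by rewrite /lext msupp0 big_seq_fset0. Qed.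

Lemma lextU i a : lext << a *g i >> = F i a.
Proof. by rewrite (lextw msuppU_le) big_seq_fset1 mcoeffUU. Qed.

End LinearExtension.

Lemma malg_ind (I : choiceType) (A : zmodType) (P : {malg A[I]} -> Prop) :
    P 0 -> (forall f g, P f -> P g -> P (f + g)) ->
    (forall a i, P << a *g i >>) ->
  forall f, P f.
Proof.
move=> P0 PD PU f; rewrite [f]monalgE.
by elim/big_ind: _ => // i _; apply: PU.
Qed.

Section TwistedConvolution.
Context (G : choiceType) (op : G -> G -> G) (A : zmodType).
Context (mu : G -> G -> A -> A -> A).
Hypothesis muDl : forall g g' b, {morph mu g g' ^~ b : a a' / a + a'}.
Hypothesis muDr : forall g g' a, {morph mu g g' a : b b' / b + b'}.

Definition tconv (f f' : {malg A[G]}) : {malg A[G]} :=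
  \sum_(g <- msupp f) \sum_(g' <- msupp f')
    << mu g g' f@_g f'@_g' *g op g g' >>.

Let Fr g a (g' : G) b : {malg A[G]} := << mu g g' a b *g op g g' >>.
Let FrD g a g' : {morph Fr g a g' : b b' / b + b'}.
Proof. by move=> b b'; rewrite /Fr muDr monalgUD. Qed.
Let Fl f' g a := lext (Fr g a) f'.
Let FlD f' g : {morph Fl f' g : a a' / a + a'}.
Proof.
move=> a a'; rewrite /Fl /lext -big_split; apply: eq_bigr => g' _ /=.
by rewrite /Fr muDl monalgUD.
Qed.
Let tconvE f f' : tconv f f' = lext (Fl f') f.
Proof. by []. Qed.

Lemma tconvDl : left_distributive tconv +%R.
Proof. by move=> f f' f''; rewrite !tconvE (lextD (FlD _)). Qed.

Lemma tconvDr : right_distributive tconv +%R.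
Proof.
move=> f f' f''; rewrite !tconvE /lext -big_split; apply: eq_bigr => g _ /=.
exact: (lextD (FrD _ _)).
Qed.

Lemma tconv0l f : tconv 0 f = 0.
Proof. by rewrite tconvE lext0. Qed.

Lemma tconv0r f : tconv f 0 = 0.
Proof. by apply: (addrI (tconv f 0)); rewrite -tconvDr !addr0. Qed.

Lemma tconvUU a g b g' :
  tconv << a *g g >> << b *g g' >> = << mu g g' a b *g op g g' >>.
Proof. by rewrite tconvE (lextU (FlD _)) /Fl (lextU (FrD _ _)). Qed.

Lemma tconvA : associative op ->
    (forall g1 g2 g3 a1 a2 a3,
      mu g1 (op g2 g3) a1 (mu g2 g3 a2 a3)
      = mu (op g1 g2) g3 (mu g1 g2 a1 a2) a3) ->
  associative tconv.
Proof.
move=> opA muA x y z; elim/malg_ind: x => [|x x' IH IH'|a g].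
- by rewrite !tconv0l.
- by rewrite !tconvDl IH IH'.
elim/malg_ind: y => [|y y' IH IH'|b g'].
- by rewrite tconv0r !tconv0l tconv0r.
- by rewrite tconvDl !tconvDr tconvDl IH IH'.
elim/malg_ind: z => [|z z' IH IH'|c g''].
- by rewrite !tconv0r.
- by rewrite !tconvDr IH IH'.
by rewrite !tconvUU opA muA.
Qed.

Lemma tconv1l e u : left_id e op -> (forall g a, mu e g u a = a) ->
  left_id << u *g e >> tconv.
Proof.
move=> op1 mu1; elim/malg_ind => [|x x' IH IH'|a g].
- exact: tconv0r.
- by rewrite tconvDr IH IH'.
- by rewrite tconvUU op1 mu1.
Qed.

Lemma tconv1r e u : right_id e op -> (forall g a, mu g e a u = a) ->
  right_id << u *g e >> tconv.
Proof.
move=> op1 mu1; elim/malg_ind => [|x x' IH IH'|a g].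
- exact: tconv0l.
- by rewrite tconvDl IH IH'.
- by rewrite tconvUU op1 mu1.
Qed.

Lemma tconv_morphl (s : {malg A[G]} -> {malg A[G]}) (s0 : A -> A) :
    s 0 = 0 -> {morph s : x y / x + y} ->
    (forall a g, s << a *g g >> = << s0 a *g g >>) ->
    (forall g g' a b, s0 (mu g g' a b) = mu g g' (s0 a) b) ->
  forall x y, s (tconv x y) = tconv (s x) y.
Proof.
move=> sz sD sU s0mu x y; elim/malg_ind: x => [|x x' IH IH'|a g].
- by rewrite sz tconv0l sz.
- by rewrite tconvDl !sD IH IH' tconvDl.
elim/malg_ind: y => [|y y' IH IH'|b g'].
- by rewrite !tconv0r sz.
- by rewrite !tconvDr sD IH IH'.
by rewrite sU !tconvUU sU s0mu.
Qed.

Lemma tconv_morphr (s : {malg A[G]} -> {malg A[G]}) (s0 : A -> A) :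
    s 0 = 0 -> {morph s : x y / x + y} ->
    (forall a g, s << a *g g >> = << s0 a *g g >>) ->
    (forall g g' a b, s0 (mu g g' a b) = mu g g' a (s0 b)) ->
  forall x y, s (tconv x y) = tconv x (s y).
Proof.
move=> sz sD sU s0mu x y; elim/malg_ind: x => [|x x' IH IH'|a g].
- by rewrite !tconv0l sz.
- by rewrite !tconvDl sD IH IH'.
elim/malg_ind: y => [|y y' IH IH'|b g'].
- by rewrite sz tconv0r sz.
- by rewrite !(tconvDr, sD) IH IH'.
by rewrite sU !tconvUU sU s0mu.
Qed.

End TwistedConvolution.

(* -------------------------------------------------------------------------- *)
Definition group_ring (K : comNzRingType) (G : groupType) : Type :=
  {malg K[G]}.

HB.instance Definition _ (K : comNzRingType) (G : groupType) :=
  GRing.Lmodule.copy (group_ring K G) {malg K[G]}.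

HB.lock Definition gr_mul (K : comNzRingType) (G : groupType)
    (f f' : group_ring K G) : group_ring K G :=
  \sum_(g <- msupp f) \sum_(g' <- msupp f')
    << f@_g * f'@_g' *g (g * g')%g >>.

Section GroupRing.
Context (K : comNzRingType) (G : groupType).
Implicit Types (f : group_ring K G) (g : G) (c : K).
Local Notation gr_mul := (@gr_mul K G).

Definition delta g : group_ring K G := << 1 *g g >>.

Let mu (_ _ : G) (a b : K) := a * b.
Let muDl g g' b : {morph mu g g' ^~ b : a a' / a + a'}.
Proof. by move=> a a'; apply: mulrDl. Qed.
Let muDr g g' a : {morph mu g g' a : b b' / b + b'}.
Proof. by move=> b b'; apply: mulrDr. Qed.
Let gr_mulE : gr_mul = tconv (fun g g' : G => (g * g')%g) mu.
Proof. by rewrite gr_mul.unlock. Qed.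

Fact gr_mulA : associative gr_mul.
Proof. rewrite gr_mulE; by apply: (tconvA muDl muDr) => *; [apply: mulgA | apply: mulrA]. Qed.
Fact gr_mul1l : left_id (delta 1%g) gr_mul.
Proof. rewrite gr_mulE; by apply: (tconv1l muDl muDr) => *; [apply: mul1g | apply: mul1r]. Qed.
Fact gr_mul1r : right_id (delta 1%g) gr_mul.
Proof. rewrite gr_mulE; by apply: (tconv1r muDl muDr) => *; [apply: mulg1 | apply: mulr1]. Qed.
Fact gr_mulDl : left_distributive gr_mul +%R.
Proof. rewrite gr_mulE; exact: (tconvDl _ muDl). Qed.
Fact gr_mulDr : right_distributive gr_mul +%R.
Proof. rewrite gr_mulE; exact: (tconvDr _ muDr). Qed.
Fact gr_one_neq0 : delta 1%g != 0.
Proof. by rewrite monalgU_eq0 oner_eq0. Qed.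

HB.instance Definition _ := GRing.Zmodule_isNzRing.Build (group_ring K G)
  gr_mulA gr_mul1l gr_mul1r gr_mulDl gr_mulDr gr_one_neq0.

Let scaleU c a g : c *: (<< a *g g >> : group_ring K G) = << c * a *g g >>.
Proof. by apply/malgP => k; rewrite mcoeffZ !mcoeffU mulrnAr. Qed.

Let gr_mulrE f f' : f * f' = tconv (fun g g' : G => (g * g')%g) mu f f'.
Proof. by rewrite -gr_mulE. Qed.

Fact gr_scaleAl c f f' : c *: (f * f') = c *: f * f'.
Proof.
rewrite !gr_mulrE.
apply: (tconv_morphl _ muDl muDr (s := fun x => c *: (x : group_ring K G))
          (s0 := *%R c)).
- exact: scaler0.
- exact: scalerDr.
- exact: scaleU.
- by move=> *; apply: mulrA.
Qed.

Fact gr_scaleAr c f f' : c *: (f * f') = f * (c *: f').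
Proof.
rewrite !gr_mulrE.
apply: (tconv_morphr _ muDl muDr (s := fun x => c *: (x : group_ring K G))
          (s0 := *%R c)).
- exact: scaler0.
- exact: scalerDr.
- exact: scaleU.
- by move=> *; apply: mulrCA.
Qed.

HB.instance Definition _ :=
  GRing.Lmodule_isLalgebra.Build K (group_ring K G) gr_scaleAl.
HB.instance Definition _ :=
  GRing.Lalgebra_isAlgebra.Build K (group_ring K G) gr_scaleAr.

Lemma gr_mulUU a g b g' :
  (<< a *g g >> : group_ring K G) * (<< b *g g' >> : group_ring K G)
  = << a * b *g (g * g')%g >>.
Proof. rewrite gr_mulrE; exact: (tconvUU _ muDl muDr). Qed.

Lemma gr_scaleU c a g :
  c *: (<< a *g g >> : group_ring K G) = << c * a *g g >>.
Proof. exact: scaleU. Qed.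

Lemma deltaM g g' : delta g * delta g' = delta (g * g')%g.
Proof. by rewrite gr_mulUU mulr1. Qed.

Lemma gr_ind (P : group_ring K G -> Prop) :
    P 0 -> (forall f f', P f -> P f' -> P (f + f')) ->
    (forall a g, P << a *g g >>) ->
  forall f, P f.
Proof. exact: malg_ind. Qed.

End GroupRing.

Arguments delta {K G} g%_group_scope.

(* -------------------------------------------------------------------------- *)
Definition invertible (R : nzRingType) (x : R) : Prop :=
  exists y, x * y = 1 /\ y * x = 1.

(* (cs_act, cs_coc) is the pair (S, omega), with S h an algebra automorphism of A
   and omega h h' a unit of A; the identities are what makes [cp_mul] associative
   with unit d_1.                                                             *)
Record crossed_system (K : comNzRingType) (A : algType K) (H : groupType) :=
  CrossedSystem {
    cs_act : H -> {lrmorphism A -> A};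
    cs_coc : H -> H -> A;
    cs_act_bij : forall h, bijective (cs_act h);
    cs_coc_inv : forall h h', invertible (cs_coc h h');
    cs_act1 : forall a, cs_act 1%g a = a;
    cs_coc1l : forall h, cs_coc 1%g h = 1;
    cs_coc1r : forall h, cs_coc h 1%g = 1;
    cs_actM : forall h h' a,
      cs_act h (cs_act h' a) * cs_coc h h'
      = cs_coc h h' * cs_act (h * h')%g a;
    cs_cocM : forall h h' h'',
      cs_coc h h' * cs_coc (h * h')%g h''
      = cs_act h (cs_coc h' h'') * cs_coc h (h' * h'')%g
  }.

(* A free left A-module on H: [{malg A[H]}] with multiplication [cp_mul]. *)
Definition crossed_product (K : comNzRingType) (A : algType K) (H : groupType)
  (X : crossed_system A H) : Type := {malg A[H]}.

HB.instance Definition _ (K : comNzRingType) (A : algType K) (H : groupType)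
  (X : crossed_system A H) := GRing.Zmodule.copy (crossed_product X) {malg A[H]}.

(* [cp_mono X a h] is the element a d_h *)
Definition cp_mono (K : comNzRingType) (A : algType K) (H : groupType)
  (X : crossed_system A H) (a : A) (h : H) : crossed_product X := << a *g h >>.
Arguments cp_mono {K A H} X a h%_group_scope.

HB.lock Definition cp_mul (K : comNzRingType) (A : algType K) (H : groupType)
    (X : crossed_system A H) (x y : crossed_product X) : crossed_product X :=
  \sum_(h <- msupp x) \sum_(h' <- msupp y)
    cp_mono X (x@_h * cs_act X h y@_h' * cs_coc X h h') (h * h').

Section CrossedProduct.
Context (K : comNzRingType) (A : algType K) (H : groupType).
Context (X : crossed_system A H).
Local Notation S := (cs_act X).
Local Notation w := (cs_coc X).
Local Notation CP := (crossed_product X).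
Implicit Types (x y : CP) (h : H) (a b : A) (c : K).

Local Notation cp_mul := (@cp_mul K A H X).
Local Notation cp_mono := (cp_mono X).

Let mu h h' a b := a * S h b * w h h'.
Let muDl h h' b : {morph mu h h' ^~ b : a a' / a + a'}.
Proof. by move=> a a'; rewrite /mu !mulrDl. Qed.
Let muDr h h' a : {morph mu h h' a : b b' / b + b'}.
Proof. by move=> b b'; rewrite /mu rmorphD mulrDr mulrDl. Qed.

Let cp_mulE : cp_mul = tconv (fun h h' : H => (h * h')%g) mu.
Proof. by rewrite cp_mul.unlock. Qed.

Fact cp_mulA : associative cp_mul.
Proof.
rewrite cp_mulE; apply: (tconvA muDl muDr); first exact: mulgA.
move=> h1 h2 h3 a1 a2 a3; rewrite /mu !rmorphM /= -!mulrA; do 2!congr (_ * _).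
by rewrite -cs_cocM !mulrA cs_actM.
Qed.
Fact cp_mul1l : left_id (cp_mono 1 1%g) cp_mul.
Proof.
rewrite cp_mulE; apply: (tconv1l muDl muDr); first exact: mul1g.
by move=> h a; rewrite /mu cs_act1 cs_coc1l mul1r mulr1.
Qed.
Fact cp_mul1r : right_id (cp_mono 1 1%g) cp_mul.
Proof.
rewrite cp_mulE; apply: (tconv1r muDl muDr); first exact: mulg1.
by move=> h a; rewrite /mu rmorph1 cs_coc1r !mulr1.
Qed.
Fact cp_mulDl : left_distributive cp_mul +%R.
Proof. rewrite cp_mulE; exact: (tconvDl _ muDl). Qed.
Fact cp_mulDr : right_distributive cp_mul +%R.
Proof. rewrite cp_mulE; exact: (tconvDr _ muDr). Qed.
Fact cp_one_neq0 : cp_mono 1 1%g != 0.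
Proof. by rewrite monalgU_eq0 oner_eq0. Qed.

HB.instance Definition _ := GRing.Zmodule_isNzRing.Build CP
  cp_mulA cp_mul1l cp_mul1r cp_mulDl cp_mulDr cp_one_neq0.

(* The action of the scalars K; [malg] itself is a left A-module. *)
Definition cp_scale c x : CP := c%:A *: (x : {malg A[H]}).

Lemma cp_scaleE c x h : (cp_scale c x)@_h = c *: x@_h.
Proof. by rewrite mcoeffZ mulr_algl. Qed.

Fact cp_scaleA c1 c2 x : cp_scale c1 (cp_scale c2 x) = cp_scale (c1 * c2) x.
Proof. by apply/malgP => h; rewrite !cp_scaleE scalerA. Qed.
Fact cp_scale1 : left_id 1 cp_scale.
Proof. by move=> x; apply/malgP => h; rewrite cp_scaleE scale1r. Qed.
Fact cp_scaleDr : right_distributive cp_scale +%R.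
Proof.
move=> c x y; apply/malgP => h.
by rewrite mcoeffD !cp_scaleE -scalerDr -mcoeffD.
Qed.
Fact cp_scaleDl x : {morph cp_scale^~ x : c1 c2 / c1 + c2}.
Proof.
move=> c1 c2; apply/malgP => h.
by rewrite mcoeffD !cp_scaleE -scalerDl.
Qed.

HB.instance Definition _ := GRing.Zmodule_isLmodule.Build K CP
  cp_scaleA cp_scale1 cp_scaleDr cp_scaleDl.

Lemma cp_scaleU c a h : c *: cp_mono a h = cp_mono (c *: a) h.
Proof. by apply/malgP => k; rewrite cp_scaleE !mcoeffU scalerMnr. Qed.

Let cp_mulrE x y : x * y = tconv (fun h h' : H => (h * h')%g) mu x y.
Proof. by rewrite -cp_mulE. Qed.

Fact cp_scaleAl c x y : c *: (x * y) = c *: x * y.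
Proof.
rewrite !cp_mulrE.
apply: (tconv_morphl _ muDl muDr (s := fun x => c *: (x : CP))
          (s0 := fun a => c *: a)).
- exact: scaler0.
- exact: scalerDr.
- by move=> a h; apply: cp_scaleU.
- by move=> *; rewrite /mu !scalerAl.
Qed.

Fact cp_scaleAr c x y : c *: (x * y) = x * (c *: y).
Proof.
rewrite !cp_mulrE.
apply: (tconv_morphr _ muDl muDr (s := fun x => c *: (x : CP))
          (s0 := fun a => c *: a)).
- exact: scaler0.
- exact: scalerDr.
- by move=> a h; apply: cp_scaleU.
- by move=> *; rewrite /mu linearZ /= -scalerAr -scalerAl.
Qed.

HB.instance Definition _ := GRing.Lmodule_isLalgebra.Build K CP cp_scaleAl.
HB.instance Definition _ := GRing.Lalgebra_isAlgebra.Build K CP cp_scaleAr.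

Lemma cp_mulUU a h b h' :
  cp_mono a h * cp_mono b h' = cp_mono (a * S h b * w h h') (h * h')%g.
Proof. rewrite cp_mulrE; exact: (tconvUU _ muDl muDr). Qed.

Definition cp_component h x : Prop := exists a, x = cp_mono a h.

End CrossedProduct.

Arguments cp_component {K A H} X h%_group_scope x.

(* -------------------------------------------------------------------------- *)
(* [{malg R[H]}] serves as the type of finitely supported families in R indexed
   by H; [graded_sum] says that R is the direct sum of the D h.              *)
Record is_graded (R : nzRingType) (H : groupType) (D : H -> R -> Prop) :
    Prop := IsGraded {
  graded0 : forall h, D h 0;
  gradedB : forall h x y, D h x -> D h y -> D h (x - y);
  graded_sum : forall x, exists! c : {malg R[H]},
    (forall h, D h c@_h) /\ x = \sum_(h <- msupp c) c@_h;
  gradedM : forall h h' x y, D h x -> D h' y -> D (h * h')%g (x * y)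
}.

Definition is_crossed_product (R : nzRingType) (H : groupType)
    (D : H -> R -> Prop) : Prop :=
  is_graded D /\ forall h, exists x, D h x /\ invertible x.

Definition is_crossed_product_iso (K : comNzRingType) (R S : algType K)
    (H : groupType) (DR : H -> R -> Prop) (DS : H -> S -> Prop)
    (phi : {lrmorphism R -> S}) : Prop :=
  bijective phi /\
  forall h y, DS h y <-> exists x, DR h x /\ phi x = y.

(* -------------------------------------------------------------------------- *)
Record short_exact_sequence (N G H : groupType) := ShortExactSequence {
  ses_inj : UMagmaMorphism.type N G;
  ses_proj : UMagmaMorphism.type G H;
  ses_injective : injective ses_inj;
  ses_exact : forall g, ses_proj g = 1%g <-> exists n, ses_inj n = g;
  ses_surjective : forall h, exists g, ses_proj g = h
}.

Record normalized_section (N G H : groupType)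
    (E : short_exact_sequence N G H) := NormalizedSection {
  section_fun :> H -> G;
  section_proj : forall h, ses_proj E (section_fun h) = h;
  section1 : section_fun 1%g = 1%g
}.

Section KernelPoint.
Context (N G H : groupType) (E : short_exact_sequence N G H).
Local Notation i := (ses_inj E).
Local Notation q := (ses_proj E).

Fact ses_ker_ex g : q g == 1%g -> exists n, i n == g.
Proof. by move/eqP/ses_exact => [n <-]; exists n. Qed.

(* [ker_pt g] is g seen as an element of N; it is only relevant when q g = 1 *)
Definition ker_pt g : N :=
  match boolP (q g == 1%g) with
  | AltTrue qg => xchoose (ses_ker_ex qg)
  | AltFalse _ => 1%g
  end.

Lemma ker_ptK g : q g = 1%g -> i (ker_pt g) = g.
Proof.
move=> /eqP qg; rewrite /ker_pt; case: {-}_ / boolP => [p|]; last by rewrite qg.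
exact/eqP/(xchooseP (ses_ker_ex p)).
Qed.

Lemma proj_inj n : q (i n) = 1%g.
Proof. by apply/ses_exact; exists n. Qed.

Lemma ker_pt_inj n : ker_pt (i n) = n.
Proof. exact/(@ses_injective _ _ _ E)/ker_ptK/proj_inj. Qed.

End KernelPoint.

(* Inclusion K[N] -> K[G], and restriction to N of a function on G *)
HB.lock Definition gr_incl (K : comNzRingType) (N G H : groupType)
    (E : short_exact_sequence N G H) (f : group_ring K N) : group_ring K G :=
  \sum_(n <- msupp f) << f@_n *g ses_inj E n >>.

HB.lock Definition gr_restr (K : comNzRingType) (N G H : groupType)
    (E : short_exact_sequence N G H) (f : group_ring K G) : group_ring K N :=
  \sum_(g <- msupp f | ses_proj E g == 1%g) << f@_g *g ker_pt E g >>.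

Section Extension.
Context (K : comNzRingType) (N G H : groupType).
Context (E : short_exact_sequence N G H).
Local Notation i := (ses_inj E).
Local Notation q := (ses_proj E).
Local Notation KN := (group_ring K N).
Local Notation KG := (group_ring K G).
Local Notation gr_incl := (@gr_incl K N G H E).
Local Notation gr_restr := (@gr_restr K N G H E).
Local Notation ker_pt := (ker_pt E).

Let inclF n (a : K) : KG := << a *g i n >>.
Let inclFD n : {morph inclF n : a b / a + b}.
Proof. by move=> a b; apply: monalgUD. Qed.

Let inclE f : gr_incl f = lext inclF f.
Proof. by rewrite gr_incl.unlock. Qed.

Lemma gr_inclD : {morph gr_incl : f g / f + g}.
Proof. by move=> f g; rewrite !inclE (lextD inclFD). Qed.
Lemma gr_inclU a n : gr_incl << a *g n >> = << a *g i n >>.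
Proof. by rewrite inclE (lextU inclFD). Qed.
Lemma gr_incl0 : gr_incl 0 = 0.
Proof. by rewrite inclE lext0. Qed.

Let restrF g (a : K) : KN := if q g == 1%g then << a *g ker_pt g >> else 0.
Let restrFD g : {morph restrF g : a b / a + b}.
Proof. by rewrite /restrF => a b; case: eqP; rewrite ?monalgUD ?addr0. Qed.
Let restrE f : gr_restr f = lext restrF f.
Proof. by rewrite gr_restr.unlock big_mkcond. Qed.

Lemma gr_restrD : {morph gr_restr : f g / f + g}.
Proof. by move=> f g; rewrite !restrE (lextD restrFD). Qed.
Lemma gr_restr0 : gr_restr 0 = 0.
Proof. by rewrite restrE lext0. Qed.
Lemma gr_restrU a g : q g = 1%g -> gr_restr << a *g g >> = << a *g ker_pt g >>.
Proof. by move=> qg; rewrite restrE (lextU restrFD) /restrF qg eqxx. Qed.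

Lemma gr_inclK : cancel gr_incl gr_restr.
Proof.
elim/gr_ind => [|f f' IH IH'|a n].
- by rewrite gr_incl0 gr_restr0.
- by rewrite gr_inclD gr_restrD IH IH'.
- by rewrite gr_inclU (gr_restrU _ (proj_inj E n)) ker_pt_inj.
Qed.

Lemma gr_incl_injective : injective gr_incl.
Proof. exact: can_inj gr_inclK. Qed.

Lemma gr_incl_delta n : gr_incl (delta n) = delta (i n).
Proof. exact: gr_inclU. Qed.

Lemma gr_incl1 : gr_incl 1 = 1.
Proof. by rewrite gr_incl_delta gmulf1. Qed.

Lemma gr_inclM : {morph gr_incl : f g / f * g}.
Proof.
move=> f f'; elim/gr_ind: f => [|f g IH IH'|a n].
- by rewrite mul0r gr_incl0 mul0r.
- by rewrite mulrDl !gr_inclD IH IH' mulrDl.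
elim/gr_ind: f' => [|f g IH IH'|b n'].
- by rewrite mulr0 gr_incl0 mulr0.
- by rewrite mulrDr !gr_inclD IH IH' mulrDr.
by rewrite gr_mulUU !gr_inclU gr_mulUU gmulfM.
Qed.

Lemma gr_inclZ c : {morph gr_incl : f / c *: f}.
Proof.
elim/gr_ind => [|f g IH IH'|a n].
- by rewrite scaler0 gr_incl0 scaler0.
- by rewrite scalerDr !gr_inclD IH IH' scalerDr.
by rewrite gr_scaleU !gr_inclU gr_scaleU.
Qed.

Context (s : normalized_section E).

Let conjD (u v : KG) (f g : KN) : u * gr_incl (f + g) * v =
  u * gr_incl f * v + u * gr_incl g * v.
Proof. by rewrite gr_inclD (mulrDr u) mulrDl. Qed.

Definition ext_coc h h' : N := ker_pt (s h * s h' * (s (h * h')%g)^-1)%g.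

Lemma ext_cocK h h' : i (ext_coc h h') = (s h * s h' * (s (h * h')%g)^-1)%g.
Proof. by apply: ker_ptK; rewrite !gmulfM gmulfV !section_proj mulgV. Qed.

(* Conjugation by delta (s h), computed in K[G]; the result is supported on N
   (see [ext_actK]), so restricting it to N loses nothing.                   *)
Definition ext_act h (f : KN) : KN :=
  gr_restr (delta (s h) * gr_incl f * delta (s h)^-1).

Lemma ext_actK h f :
  gr_incl (ext_act h f) = delta (s h) * gr_incl f * delta (s h)^-1.
Proof.
rewrite /ext_act; elim/gr_ind: f => [|f g IH IH'|a n].
- by rewrite gr_incl0 mulr0 mul0r gr_restr0 gr_incl0.
- by rewrite conjD gr_restrD gr_inclD; congr (_ + _).
have qn : q (s h * i n * (s h)^-1)%g = 1%g.
  by rewrite !gmulfM gmulfV proj_inj mulg1 mulgV.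
by rewrite gr_inclU !gr_mulUU (gr_restrU _ qn) gr_inclU ker_ptK.
Qed.

Let sM h h' : delta (s h) * delta (s h') =
  gr_incl (delta (ext_coc h h')) * delta (s (h * h')%g) :> KG.
Proof. by rewrite gr_incl_delta ext_cocK !deltaM mulgVK. Qed.
Let sV h : delta (s h)^-1 * delta (s h) = 1 :> KG.
Proof. by rewrite deltaM mulVg. Qed.
Let Vs h : delta (s h) * delta (s h)^-1 = 1 :> KG.
Proof. by rewrite deltaM mulgV. Qed.

Fact ext_act_zmod h : zmod_morphism (ext_act h).
Proof.
have D f g : ext_act h (f + g) = ext_act h f + ext_act h g.
  by rewrite /ext_act conjD gr_restrD.
by move=> f g; apply: (addIr (ext_act h g)); rewrite -D !subrK.
Qed.
Fact ext_act_monoid h : GRing.monoid_morphism (ext_act h).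
Proof.
split; first by apply: gr_incl_injective; rewrite ext_actK gr_incl1 mulr1 Vs.
move=> f g; apply: gr_incl_injective; rewrite gr_inclM !ext_actK gr_inclM.
by rewrite !mulrA -(mulrA _ (delta _) (delta _)) sV mulr1.
Qed.
Fact ext_act_scale h : scalable (ext_act h).
Proof.
move=> c f; apply: gr_incl_injective; rewrite gr_inclZ !ext_actK gr_inclZ.
by rewrite -scalerAr -scalerAl.
Qed.
HB.instance Definition _ h :=
  GRing.isZmodMorphism.Build KN KN (ext_act h) (ext_act_zmod h).
HB.instance Definition _ h :=
  GRing.isMonoidMorphism.Build KN KN (ext_act h) (ext_act_monoid h).
HB.instance Definition _ h :=
  GRing.isScalable.Build K KN KN *:%R (ext_act h) (ext_act_scale h).

Fact ext_act_bij h : bijective (ext_act h).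
Proof.
pose b f := gr_restr (delta (s h)^-1 * gr_incl f * delta (s h)).
have bK f : gr_incl (b f) = delta (s h)^-1 * gr_incl f * delta (s h).
  rewrite /b; elim/gr_ind: f => [|f g IH IH'|a n].
  - by rewrite gr_incl0 mulr0 mul0r gr_restr0 gr_incl0.
  - by rewrite conjD gr_restrD gr_inclD; congr (_ + _).
  have qn : q ((s h)^-1 * i n * s h)%g = 1%g.
    by rewrite !gmulfM gmulfV proj_inj mulg1 mulVg.
  by rewrite gr_inclU !gr_mulUU (gr_restrU _ qn) gr_inclU ker_ptK.
exists b => f; apply: gr_incl_injective.
- by rewrite bK ext_actK !mulrA sV mul1r -mulrA sV mulr1.
- by rewrite ext_actK bK !mulrA Vs mul1r -mulrA Vs mulr1.
Qed.

Fact ext_coc_inv h h' : invertible (delta (ext_coc h h') : KN).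
Proof.
by exists (delta (ext_coc h h')^-1); rewrite !deltaM mulgV mulVg.
Qed.
Fact ext_act1 f : ext_act 1%g f = f.
Proof.
by apply: gr_incl_injective; rewrite ext_actK section1 invg1 mul1r mulr1.
Qed.
Fact ext_coc1l h : delta (ext_coc 1%g h) = 1 :> KN.
Proof.
apply: gr_incl_injective.
by rewrite gr_incl_delta ext_cocK section1 !mul1g mulgV gr_incl1.
Qed.
Fact ext_coc1r h : delta (ext_coc h 1%g) = 1 :> KN.
Proof.
apply: gr_incl_injective.
by rewrite gr_incl_delta ext_cocK section1 !mulg1 mulgV gr_incl1.
Qed.
Fact ext_actM h h' f :
  ext_act h (ext_act h' f) * delta (ext_coc h h')
  = delta (ext_coc h h') * ext_act (h * h')%g f.
Proof.
apply: gr_incl_injective; rewrite !gr_inclM !ext_actK !gr_incl_delta !mulrA.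
rewrite !deltaM ext_cocK mulgVK -!mulrA !deltaM; congr (_ * (_ * delta _)).
by rewrite !mulgA mulgVK mulVg mul1g.
Qed.
Fact ext_cocM h h' h'' :
  delta (ext_coc h h') * delta (ext_coc (h * h')%g h'')
  = ext_act h (delta (ext_coc h' h'')) * delta (ext_coc h (h' * h'')%g) :> KN.
Proof.
apply: gr_incl_injective; rewrite !gr_inclM !ext_actK !gr_incl_delta !deltaM.
by rewrite !ext_cocK !mulgA !mulgVK.
Qed.

Definition ext_crossed_system : crossed_system KN H :=
  @CrossedSystem K KN H (fun h => ext_act h)
    (fun h h' => delta (ext_coc h h'))
    ext_act_bij ext_coc_inv ext_act1 ext_coc1l ext_coc1r ext_actM ext_cocM.

Definition gr_component h (f : KG) : Prop :=
  exists a : KN, f = gr_incl a * delta (s h).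

End Extension.

(* Main.v *)
(** Every g in G factors uniquely as n sigma(h), with h = q g and
    n = g sigma(q g)^-1 in N. On basis elements this factorization sends
    a delta_g to (a delta_n) d_(q g), and its linear extension inverts the map
    a d_h |-> a * delta_(sigma h). The latter is multiplicative because
    delta_(sigma h) * b = S(h)(b) * delta_(sigma h) and
    delta_(sigma h) * delta_(sigma h') = w(h, h') * delta_(sigma (hh')). *)

Require Import Defs.
From HB Require Import structures.
From mathcomp Require Import all_boot all_order all_algebra finmap complex reals.
From mathcomp Require Import monalg.

Set Implicit Arguments.
Unset Strict Implicit.
Unset Printing Implicit Defensive.

Import GRing.Theory.
Local Open Scope ring_scope.

(* [lext (fun=> id) c] is [\sum_(h <- msupp c) c@_h]; [p] sends an element to
   the family of its homogeneous components. *)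
Lemma is_graded_decomp (R : nzRingType) (H : groupType) (D : H -> R -> Prop)
    (p : R -> {malg R[H]}) :
    (forall h, D h 0) ->
    (forall h x y, D h x -> D h y -> D h (x - y)) ->
    (forall h h' x y, D h x -> D h' y -> D (h * h')%g (x * y)) ->
    {morph p : x y / x + y} ->
    (forall x h, D h (p x)@_h) ->
    (forall x, lext (fun=> id) (p x) = x) ->
    (forall h x, D h x -> p x = << x *g h >>) ->
  is_graded D.
Proof.
move=> D0 DB DM pD Dp pK pU; split=> // x; exists (p x).
split=> [|c [Dc ->]]; first by split=> [h|]; [apply: Dp | rewrite -[LHS]pK].
have p0 : p 0 = 0 by apply: (addrI (p 0)); rewrite -pD !addr0.
(* Uniqueness: [p] applied to the sum of any admissible family [c] gives back [c], since [p] is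
   additive and places each homogeneous [c@_h] in degree [h]. *)
rewrite [RHS]monalgE (big_morph p pD p0).
by apply: eq_bigr => h _; apply: pU.
Qed.

(** * Grading and homogeneous units of a crossed product *)

Section CrossedProductGrading.
Context (K : comNzRingType) (A : algType K) (H : groupType).
Context (X : crossed_system A H).
Local Notation CP := (crossed_product X).

Lemma cp_monoD h : {morph cp_mono X ^~ h : a b / a + b}.
Proof. by move=> a b; apply: monalgUD. Qed.

Lemma cp_mono0 h : cp_mono X 0 h = 0.
Proof. exact: monalgU0. Qed.

Lemma cp_ind (P : CP -> Prop) :
    P 0 -> (forall x y, P x -> P y -> P (x + y)) ->
    (forall a h, P (cp_mono X a h)) ->
  forall x, P x.
Proof. exact: malg_ind. Qed.

Lemma cp_component0 h : cp_component X h 0.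
Proof. by exists 0; rewrite cp_mono0. Qed.

Lemma cp_componentD h x y :
  cp_component X h x -> cp_component X h y -> cp_component X h (x + y).
Proof. by move=> [a ->] [b ->]; exists (a + b); rewrite cp_monoD. Qed.

Lemma cp_is_graded : is_graded (cp_component X).
Proof.
(* The decomposition map sends a d_h to the family whose only possibly nonzero entry is a d_h
   itself, at index [h]. *)
pose pF h (a : A) : {malg CP[H]} := << cp_mono X a h *g h >>.
have pFD h : {morph pF h : a b / a + b}.
  by move=> a b; rewrite /pF cp_monoD monalgUD.
pose p (x : CP) : {malg CP[H]} := lext pF x.
have pD : {morph p : x y / x + y} by apply: lextD pFD.
have pU a h : p (cp_mono X a h) = << cp_mono X a h *g h >>.
  exact: (lextU pFD).
have sD : forall h : H, {morph (id : CP -> CP) : x y / x + y} by [].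
apply: (is_graded_decomp (p := p)) => //.
- exact: cp_component0.
- move=> h x y [a ->] [b ->]; exists (a - b).
  by apply/eqP; rewrite subr_eq -cp_monoD subrK.
- by move=> h h' x y [a ->] [b ->]; rewrite cp_mulUU; eexists.
- move=> x h; elim/cp_ind: x => [|x y IH IH'|a h'].
  + by rewrite /p lext0 mcoeff0; apply: cp_component0.
  + by rewrite pD mcoeffD; apply: cp_componentD.
  rewrite pU mcoeffU; case: eqP => [->|_]; last exact: cp_component0.
  by exists a.
- elim/cp_ind => [|x y IH IH'|a h]; first by rewrite /p !lext0.
  + by rewrite pD (lextD sD) IH IH'.
  by rewrite pU (lextU sD).
by move=> h x [a ->]; apply: pU.
Qed.

(* The inverse of d_h is b d_(h^-1) with b = w(h^-1, h)^-1 on the left, and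
   d_(h^-1) w(h, h^-1)^-1 on the right. *)
Lemma cp_mono1_invertible h : invertible (cp_mono X 1 h).
Proof.
have [u [_ uw]] := cs_coc_inv X h^-1%g h.
have [v [wv _]] := cs_coc_inv X h h^-1%g.
(* Keeping v d_1 as a separate right factor of [z] lets d_h d_(h^-1) = w(h, h^-1) d_1 be formed
   first; then [v] is met only by the trivial action of 1. *)
pose y := cp_mono X u h^-1%g; pose z := cp_mono X 1 h^-1%g * cp_mono X v 1%g.
have yx : y * cp_mono X 1 h = 1 by rewrite cp_mulUU rmorph1 mulr1 uw mulVg.
have xz : cp_mono X 1 h * z = 1.
  rewrite mulrA cp_mulUU rmorph1 !mul1r mulgV cp_mulUU mulg1 cs_act1.
  by rewrite cs_coc1l mulr1 wv.
have yz : y = z by rewrite -[y]mulr1 -xz mulrA yx mul1r.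
by exists z; split=> //; rewrite -yz.
Qed.

Lemma cp_is_crossed_product : is_crossed_product (cp_component X).
Proof.
split=> [|h]; first exact: cp_is_graded.
by exists (cp_mono X 1 h); split; [exists 1 | apply: cp_mono1_invertible].
Qed.

End CrossedProductGrading.

(** * Factorization in G and the two mutually inverse additive maps *)

Section ExtensionGroupRing.
Context (K : comNzRingType) (N G H : groupType).
Context (E : short_exact_sequence N G H) (s : normalized_section E).
Local Notation i := (ses_inj E).
Local Notation q := (ses_proj E).
Local Notation KN := (group_ring K N).
Local Notation KG := (group_ring K G).
Local Notation incl := (@gr_incl K N G H E).
Local Notation X := (ext_crossed_system K s).
Local Notation CP := (crossed_product X).

Definition ker_part g : N := ker_pt E (g * (s (q g))^-1)%g.

Lemma ker_partK g : (i (ker_part g) * s (q g))%g = g.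
Proof. by rewrite ker_ptK ?mulgVK // gmulfM gmulfV section_proj mulgV. Qed.

Lemma proj_ker_section n h : q (i n * s h)%g = h.
Proof. by rewrite gmulfM proj_inj section_proj mul1g. Qed.

Lemma ker_part_section n h : ker_part (i n * s h)%g = n.
Proof. by rewrite /ker_part proj_ker_section mulgK ker_pt_inj. Qed.

Definition gr_to_cp (f : KG) : CP :=
  lext (fun g a => cp_mono X << a *g ker_part g >> (q g)) f.

Definition cp_to_gr (x : CP) : KG :=
  lext (fun h a => incl a * delta (s h)) x.

Let gr_to_cpFD g :
  {morph (fun a => cp_mono X << a *g ker_part g >> (q g)) : a b / a + b}.
Proof. by move=> a b; rewrite monalgUD cp_monoD. Qed.

Let cp_to_grFD h : {morph (fun a => incl a * delta (s h)) : a b / a + b}.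
Proof. by move=> a b; rewrite gr_inclD mulrDl. Qed.

Lemma gr_to_cpD : {morph gr_to_cp : f g / f + g}.
Proof. exact: lextD gr_to_cpFD. Qed.

Lemma gr_to_cpU a g :
  gr_to_cp << a *g g >> = cp_mono X << a *g ker_part g >> (q g).
Proof. exact: (lextU gr_to_cpFD). Qed.

Lemma cp_to_grD : {morph cp_to_gr : x y / x + y}.
Proof. exact: lextD cp_to_grFD. Qed.

Lemma cp_to_grU a h : cp_to_gr (cp_mono X a h) = incl a * delta (s h).
Proof. exact: (lextU cp_to_grFD). Qed.

Lemma gr_to_cp0 : gr_to_cp 0 = 0. Proof. exact: lext0. Qed.
Lemma cp_to_gr0 : cp_to_gr 0 = 0. Proof. exact: lext0. Qed.

Lemma gr_to_cpK : cancel gr_to_cp cp_to_gr.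
Proof.
elim/gr_ind => [|f g IH IH'|a g]; first by rewrite gr_to_cp0 cp_to_gr0.
- by rewrite gr_to_cpD cp_to_grD IH IH'.
by rewrite gr_to_cpU cp_to_grU gr_inclU gr_mulUU mulr1 ker_partK.
Qed.

(** On a Dirac term the factorization of n sigma(h) returns exactly the pair (n, h); additivity in
    [a] does the rest. This is the defining formula of Phi in degree [h], and it yields both the
    remaining inverse law and the matching of components. *)
Lemma gr_to_cp_component a h :
  gr_to_cp (incl a * delta (s h)) = cp_mono X a h.
Proof.
elim/gr_ind: a => [|a b IH IH'|a n].
- by rewrite gr_incl0 mul0r gr_to_cp0 cp_mono0.
- by rewrite gr_inclD mulrDl gr_to_cpD IH IH' cp_monoD.
by rewrite gr_inclU gr_mulUU mulr1 gr_to_cpU ker_part_section proj_ker_section.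
Qed.

Lemma cp_to_grK : cancel cp_to_gr gr_to_cp.
Proof.
elim/cp_ind => [|x y IH IH'|a h]; first by rewrite cp_to_gr0 gr_to_cp0.
- by rewrite cp_to_grD gr_to_cpD IH IH'.
by rewrite cp_to_grU gr_to_cp_component.
Qed.

(** * Compatibility with the algebra structures *)

Lemma delta_section_incl h a :
  delta (s h) * incl a = incl (ext_act s h a) * delta (s h).
Proof. by rewrite ext_actK -!mulrA deltaM mulVg mulr1. Qed.

Lemma delta_sectionM h h' :
  delta (s h) * delta (s h')
  = incl (delta (ext_coc s h h')) * delta (s (h * h')%g).
Proof. by rewrite gr_incl_delta ext_cocK !deltaM mulgVK. Qed.

(** Moving delta_(sigma h) past [b] turns [b] into S(h)(b), and merging the two section elements
    produces the cocycle: the resulting coefficient is that of the crossed product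
    multiplication. *)
Lemma gr_componentM h h' a b :
  (incl a * delta (s h)) * (incl b * delta (s h'))
  = incl (a * ext_act s h b * delta (ext_coc s h h')) * delta (s (h * h')%g).
Proof.
rewrite -mulrA (mulrA (delta (s h))) delta_section_incl -mulrA.
by rewrite delta_sectionM !gr_inclM !mulrA.
Qed.

Lemma cp_to_grM : {morph cp_to_gr : x y / x * y}.
Proof.
move=> x y; elim/cp_ind: x => [|x x' IH IH'|a h].
- by rewrite mul0r cp_to_gr0 mul0r.
- by rewrite mulrDl !cp_to_grD IH IH' mulrDl.
elim/cp_ind: y => [|y y' IH IH'|b h'].
- by rewrite mulr0 cp_to_gr0 mulr0.
- by rewrite mulrDr !cp_to_grD IH IH' mulrDr.
by rewrite cp_mulUU !cp_to_grU gr_componentM.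
Qed.

(** The unit is d_1, and delta_(sigma(1)) = 1 because the section is normalized. *)
Lemma cp_to_gr1 : cp_to_gr 1 = 1.
Proof. by rewrite (cp_to_grU 1 1%g) gr_incl1 mul1r section1. Qed.

Lemma cp_to_grZ c : {morph cp_to_gr : x / c *: x}.
Proof.
elim/cp_ind => [|x y IH IH'|a h]; first by rewrite scaler0 cp_to_gr0 scaler0.
- by rewrite scalerDr !cp_to_grD IH IH' scalerDr.
by rewrite cp_scaleU !cp_to_grU gr_inclZ scalerAl.
Qed.

Lemma gr_to_cp_zmod : zmod_morphism gr_to_cp.
Proof. by move=> f g; apply: (addIr (gr_to_cp g)); rewrite -gr_to_cpD !subrK. Qed.

(** The laws are checked after applying the injective map [cp_to_gr], for which they are direct:
    products of monomials a d_h need no factorization of group elements. *)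
Lemma gr_to_cp_monoid : GRing.monoid_morphism gr_to_cp.
Proof.
split=> [|f g]; apply: (can_inj cp_to_grK); first by rewrite gr_to_cpK cp_to_gr1.
by rewrite cp_to_grM !gr_to_cpK.
Qed.

Lemma gr_to_cp_scale : scalable gr_to_cp.
Proof.
by move=> c f; apply: (can_inj cp_to_grK); rewrite cp_to_grZ !gr_to_cpK.
Qed.

HB.instance Definition _ :=
  GRing.isZmodMorphism.Build KG CP gr_to_cp gr_to_cp_zmod.
HB.instance Definition _ :=
  GRing.isMonoidMorphism.Build KG CP gr_to_cp gr_to_cp_monoid.
HB.instance Definition _ :=
  GRing.isScalable.Build K KG CP *:%R gr_to_cp gr_to_cp_scale.

Lemma gr_to_cp_iso :
  is_crossed_product_iso (gr_component s) (cp_component X) gr_to_cp.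
Proof.
split; first by exists cp_to_gr; [apply: gr_to_cpK | apply: cp_to_grK].
move=> h y; split=> [[a ->]|[_ [[a ->] <-]]].
- exists (incl a * delta (s h)); split; first by exists a.
  exact: gr_to_cp_component.
by exists a; apply: gr_to_cp_component.
Qed.

(** * Grading and homogeneous units of the group ring *)

Lemma gr_component0 h : gr_component s h (0 : KG).
Proof. by exists 0; rewrite gr_incl0 mul0r. Qed.

Lemma gr_componentD h (x y : KG) :
  gr_component s h x -> gr_component s h y -> gr_component s h (x + y).
Proof. by move=> [a ->] [b ->]; exists (a + b); rewrite gr_inclD mulrDl. Qed.

Lemma gr_componentU a g : gr_component s (q g) (<< a *g g >> : KG).
Proof.
by exists << a *g ker_part g >>; rewrite gr_inclU gr_mulUU mulr1 ker_partK.
Qed.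

Lemma gr_is_graded : is_graded (gr_component (K := K) s).
Proof.
(* The part of degree [h] of a function is its restriction to the fibre of [q] over [h], so the term
   at [g] goes to degree [q g]. *)
pose pF (g : G) (a : K) : {malg KG[H]} := << (<< a *g g >> : KG) *g q g >>.
have pFD g : {morph pF g : a b / a + b}.
  by move=> a b; rewrite /pF !monalgUD.
pose p (f : KG) : {malg KG[H]} := lext pF f.
have pD : {morph p : x y / x + y} by apply: lextD pFD.
have pU a g : p << a *g g >> = pF g a by apply: (lextU pFD).
have sD : forall h : H, {morph (id : KG -> KG) : x y / x + y} by [].
apply: (is_graded_decomp (p := p)) => //.
- exact: gr_component0.
- move=> h x y [a ->] [b ->]; exists (a - b).
  by apply/eqP; rewrite subr_eq -mulrDl -gr_inclD subrK.
- by move=> h h' x y [a ->] [b ->]; rewrite gr_componentM; eexists.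
- move=> f h; elim/gr_ind: f => [|f g IH IH'|a g].
  + by rewrite /p lext0 mcoeff0; apply: gr_component0.
  + by rewrite pD mcoeffD; apply: gr_componentD.
  rewrite pU mcoeffU; case: eqP => [<-|_]; last exact: gr_component0.
  exact: gr_componentU.
- elim/gr_ind => [|x y IH IH'|a g]; first by rewrite /p !lext0.
  + by rewrite pD (lextD sD) IH IH'.
  by rewrite pU (lextU sD).
move=> h _ [a ->]; elim/gr_ind: a => [|a b IH IH'|a n].
- by rewrite gr_incl0 mul0r /p lext0 monalgU0.
- by rewrite gr_inclD mulrDl pD IH IH' monalgUD.
by rewrite gr_inclU gr_mulUU pU /pF proj_ker_section.
Qed.

Lemma delta_invertible g : invertible (delta g : KG).
Proof. by exists (delta g^-1); rewrite !deltaM mulgV mulVg. Qed.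

Lemma gr_is_crossed_product : is_crossed_product (gr_component (K := K) s).
Proof.
split=> [|h]; first exact: gr_is_graded.
exists (delta (s h)); split; last exact: delta_invertible.
by exists 1; rewrite gr_incl1 mul1r.
Qed.

End ExtensionGroupRing.

Theorem theorem3p2 (R : realType) (N G H : groupType)
    (E : short_exact_sequence N G H) (s : normalized_section E) :
  let C : comNzRingType := R[i]%C in
  let X := ext_crossed_system C s in
  [/\ forall f : group_ring C G,
        exists! c : {malg (group_ring C N)[H]},
          f = \sum_(h <- msupp c) gr_incl E c@_h * delta (s h),
      is_crossed_product (gr_component (K := C) s),
      is_crossed_product (cp_component X) &
      exists Phi : {lrmorphism group_ring C G -> crossed_product X},
        (forall c : {malg (group_ring C N)[H]},
           Phi (\sum_(h <- msupp c) gr_incl E c@_h * delta (s h))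
           = \sum_(h <- msupp c) cp_mono X c@_h h) /\
        is_crossed_product_iso (gr_component s) (cp_component X) Phi].
Proof.
move=> C X; split.
(* A crossed product element is itself a family of coefficients, and the sum in the statement
   unfolds to [cp_to_gr]. Existence and uniqueness are thus the two inverse laws. *)
- move=> f; exists (gr_to_cp s f); split=> [|c ->].
    by rewrite -[LHS](gr_to_cpK s).
  exact: (cp_to_grK (c : crossed_product X)).
- exact: gr_is_crossed_product.
- exact: cp_is_crossed_product.
exists (gr_to_cp s); split=> [c|]; last exact: gr_to_cp_iso.
(* The right-hand sum is the expansion of [c] into monomials, so the formula for Phi is again an
   inverse law. *)
rewrite -[RHS]monalgE; exact: (cp_to_grK (c : crossed_product X)).
Qed.
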